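(* Let $G$ be a triangle-free strongly regular graph on $n$ vertices, and let $\mu_1(G)\geq \dots\geq \mu_n(G)$ be the eigenvalues of its adjacency matrix. Then $$\mu_1(G)+\mu_n(G)\leq 0.14n,$$ with equality if and only if $G$ is the Higman–Sims graph.
   Context: All graphs are simple. A graph $G$ is strongly regular with parameters $(n,k,a,b)$ if it has $n$ vertices, is $k$-regular, any two adjacent vertices have exactly $a$ common neighbors, and any two non-adjacent vertices have exactly $b$ common neighbors. Triangle-free means $a=0$. The Higman–Sims graph is the unique strongly regular graph with parameters $(100,22,0,6)$. *)

(* Defs.v *)
From HB Require Import structures.
From mathcomp Require Import all_boot all_order all_algebra.

Set Implicit Arguments.
Unset Strict Implicit.
Unset Printing Implicit Defensive.

Import Order.TTheory GRing.Theory Num.Theory.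

Local Open Scope ring_scope.

Definition simple_graph (T : finType) (e : rel T) : Prop :=
  symmetric e /\ irreflexive e.

Definition neighbors (T : finType) (e : rel T) (x : T) : {set T} :=
  [set y | e x y].

Definition strongly_regular (T : finType) (e : rel T) (n k a b : nat) : Prop :=
  [/\ #|T| = n,
      forall x, #|neighbors e x| = k,
      forall x y, e x y -> #|neighbors e x :&: neighbors e y| = a
    & forall x y, x != y -> ~~ e x y ->
        #|neighbors e x :&: neighbors e y| = b].

(* The Higman-Sims graph is, up to isomorphism, the unique strongly regular
   graph with parameters (100, 22, 0, 6). *)
Definition is_Higman_Sims (T : finType) (e : rel T) : Prop :=
  strongly_regular e 100 22 0 6.

Definition adjacency_mx (R : pzSemiRingType) (T : finType) (e : rel T) :
    'M[R]_#|T| :=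
  \matrix_(i, j) (e (enum_val i) (enum_val j))%:R.

(* mu lists the eigenvalues of A with multiplicity, in nonincreasing order. *)
Definition ordered_spectrum (R : rcfType) (m : nat) (A : 'M[R]_m)
    (mu : seq R) : Prop :=
  sorted >=%R mu /\ char_poly A = \prod_(x <- mu) ('X - x%:P).

(* Main.v *)
(** Let [A] be the adjacency matrix, [J] the all-ones matrix and [r], [- s] the
    roots of [x^2 + b x - (k - b)], so that [s = r + b], [k = r^2 + r b + b],
    the spectrum of [A] lies in [{k, r, - s}] and [mu_1 + mu_n = k - s].  The
    matrix [F = r I - A + ((k - r) / n) J] satisfies [F^2 = (r + s) F], so its
    rank [g] is given by its trace: [(r + s) g = k + r (n - 1)].
    Triangle-freeness makes the neighbourhood of a vertex independent, hence
    the corresponding [k x k] block of [F] is [r I + c J] with [c >= 0]; for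
    [r > 0] it is regular, so [k <= g], which simplifies to [b <= r (r + 1)].
    Integrality of [g] makes [r] an integer unless the graph is the pentagon,
    and what remains is an inequality between the integers [r] and [b]. *)

Require Import Defs.
From mathcomp Require Import all_boot all_order all_algebra.
From mathcomp Require Import zify ring lra.

Set Implicit Arguments.
Unset Strict Implicit.
Unset Printing Implicit Defensive.

Import Order.TTheory GRing.Theory Num.Theory.

Local Open Scope ring_scope.

(** * Traces and ranks *)

(** In a full-rank factorization [M = C B], cancelling [C] on the left and [B] on the right of
    [C B C B = a C B] leaves [B C = a I], of size the rank of [M]; and [C B] and [B C] have the same
    trace. *)
Lemma mxtrace_quasi_idempotent (F : fieldType) m (M : 'M[F]_m) (a : F) :
  M *m M = a *: M -> \tr M = a * (\rank M)%:R.
Proof.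
move=> MM; have CB := mulmx_base M.
have BC : row_base M *m col_base M = a%:M.
  apply: (row_full_inj (col_base_full M)).
  apply: (row_free_inj (row_base_free M)).
  rewrite mulmxA CB -mulmxA CB in MM *.
  by rewrite mul_mx_scalar -scalemxAl CB.
by rewrite -[in LHS]CB mxtrace_mulC BC mxtrace_scalar mulr_natr.
Qed.

Lemma mxrank_mxsub (F : fieldType) m n p q (f : 'I_p -> 'I_m)
    (g : 'I_q -> 'I_n) (M : 'M[F]_(m, n)) :
  (\rank (mxsub f g M) <= \rank M)%N.
Proof.
rewrite -{1}(mulmx_base M) mxsub_mul.
exact: mulmx_max_rank.
Qed.

(** Summing the equations [r u_j + c S = 0] of a kernel vector [u] with entry sum [S] gives
    [(r + m c) S = 0], so [S = 0] by positivity, and then every [u_j] vanishes. *)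
Lemma row_free_scalar_plus_const (R : realFieldType) m (r c : R) :
  0 < r -> 0 <= c -> row_free (r%:M + const_mx c : 'M[R]_m).
Proof.
move=> r0 c0; rewrite -kermx_eq0; apply/rowV0P => u /sub_kermxP uM.
have uE j : r * u 0 j + c * (\sum_i u 0 i) = 0.
  have /matrixP/(_ 0 j) := uM.
  rewrite mulmxDr mul_mx_scalar !mxE => h; rewrite -[RHS]h mulr_sumr.
  by congr (_ + _); apply: eq_bigr => i _; rewrite !mxE mulrC.
have Su : \sum_i u 0 i = 0.
  have : \sum_(j < m) (r * u 0 j + c * (\sum_i u 0 i)) = 0.
    by rewrite big1.
  rewrite big_split /= -mulr_sumr sumr_const card_ord -mulrnAl -mulrDl.
  move=> /eqP; rewrite mulf_eq0 => /orP[|/eqP //].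
  by rewrite gt_eqF // ltr_wpDr // mulrn_wge0.
apply/rowP => j; have := uE j; rewrite Su mulr0 addr0 mxE => /eqP.
by rewrite mulf_eq0 gt_eqF //= => /eqP.
Qed.

(** * Extreme entries of an ordered spectrum *)

Lemma mem_ordered_spectrum (R : rcfType) m (M : 'M[R]_m) (mu : seq R) x :
  ordered_spectrum M mu -> (x \in mu) = eigenvalue M x.
Proof. by case=> _ chM; rewrite eigenvalue_root_char chM root_prod_XsubC. Qed.

Lemma ordered_spectrum_head (R : rcfType) m (M : 'M[R]_m) (mu : seq R) x :
  ordered_spectrum M mu -> eigenvalue M x ->
  (forall y, eigenvalue M y -> y <= x) -> mu`_0 = x.
Proof.
move=> sp ex mx; have xin : x \in mu by rewrite (mem_ordered_spectrum _ sp).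
have mu0 : (0 < size mu)%N by case: (mu) xin.
apply/le_anti; rewrite mx -?(mem_ordered_spectrum _ sp) ?mem_nth //=.
rewrite -(nth_index 0 xin).
apply: (sorted_leq_nth (leT := >=%R)) => //.
- by move=> a b c /= ba; move/le_trans; apply.
- by move=> a /=.
- by case: sp.
- by rewrite inE index_mem.
Qed.

Lemma ordered_spectrum_last (R : rcfType) m (M : 'M[R]_m) (mu : seq R) x :
  ordered_spectrum M mu -> eigenvalue M x ->
  (forall y, eigenvalue M y -> x <= y) -> mu`_(size mu).-1 = x.
Proof.
move=> sp ex mx; have xin : x \in mu by rewrite (mem_ordered_spectrum _ sp).
have mu0 : ((size mu).-1 < size mu)%N by case: (mu) xin.
apply/le_anti/andP; split.
  rewrite -[leRHS](nth_index 0 xin).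
  apply: (sorted_leq_nth (leT := >=%R)) => //.
  - by move=> a b c /= ba; move/le_trans; apply.
  - by move=> a /=.
  - by case: sp.
  - by rewrite inE index_mem.
  - by rewrite -ltnS prednK ?index_mem //; case: (mu) xin.
by apply: mx; rewrite -(mem_ordered_spectrum _ sp) mem_nth.
Qed.

(** * The inequality between integers *)

(** Since [k - s = r^2 + r b - r], this is the bound [k - s <= 14 n / 100] with the subtraction
    moved across. Large [r] follows from an estimate; for [r <= 4] the Krein bound leaves finitely
    many [b]. *)
Lemma integral_parameter_bound (r b k n : nat) :
  (0 < r)%N -> (0 < b)%N -> (b <= r * r.+1)%N -> k = (r * r + r * b + b)%N ->
  (b * n + k = b * k.+1 + k * k)%N ->
  (100 * (r * r + r * b) <= 14 * n + 100 * r)%N /\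
  ((100 * (r * r + r * b) = 14 * n + 100 * r)%N ->
   [/\ n = 100, k = 22 & b = 6])%N.
Proof.
move=> r0 b0 br kE cnt.
have [r4|r5] := leqP r 4; last first.
  suff lt : (100 * (r * r + r * b) < 14 * n + 100 * r)%N.
    by split; [lia|move=> ?; split; lia].
  (* As [k >= (r + 1) b], it is enough that [100 r <= 14 (r + 1)^2]. *)
  case: b b0 br kE cnt => // b _ br kE cnt.
  (* [b] now stands for its predecessor, so [r * X] is exactly [k - s]. *)
  pose X := (r + b)%N.
  have k1 : k = (r.+1 * X).+1 by rewrite kE /X; ring.
  have cnt' : (b.+1 * n = b.+1 + k * (r.+1 * X + b.+1))%N.
    have : (b.+1 * n + k = b.+1 + k * (r.+1 * X + b.+1) + k)%N.
      by rewrite cnt {3}k1; ring.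
    lia.
  have kb : (r.+1 * b.+1 <= k)%N.
    by rewrite kE mulSn -addnA [X in (X <= _)%N]addnC leq_addl.
  have r10 : (100 * r <= 14 * (r.+1 * r.+1))%N.
    by rewrite -(subnKC r5); move: (r - 5)%N => t; lia.
  have h1 : (r.+1 * b.+1 * (r.+1 * X) <= k * (r.+1 * X))%N.
    by rewrite leq_mul2r kb orbT.
  have h2 : (100 * r * (b.+1 * X) <= 14 * (r.+1 * r.+1) * (b.+1 * X))%N.
    by rewrite leq_mul2r r10 orbT.
  have h3 : (b.+1 * (100 * (r * X)) < b.+1 * (14 * n))%N by lia.
  move: h3; rewrite ltn_mul2l /= /X mulnDr; lia.
have b20 : (b <= 20)%N.
  by rewrite (leq_trans br) // -[20%N]/(4 * 5)%N leq_mul.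
(* The inequality is multiplied by [b], so that [cnt] eliminates [n]. It is strict except at
   [r = 2], [b = 6], the Higman-Sims parameters. *)
have small : all (fun r => all (fun b => let k := (r * r + r * b + b)%N in
    [|| r * r.+1 < b, (r == 2) && (b == 6) |
      b * (100 * (r * r + r * b)) + 14 * k
        < 14 * (b * k.+1 + k * k) + b * (100 * r)])%N (iota 1 20)) (iota 1 4).
  by vm_compute.
move/allP/(_ r): small; rewrite mem_iota r0 ltnS r4 => /(_ isT).
move/allP/(_ b); rewrite mem_iota b0 ltnS b20 => /(_ isT) /=.
rewrite -kE -cnt ltnNge br /= => /orP[/andP[/eqP rE /eqP bE]|lt].
  by subst; split; [lia|move=> _; split; lia].
suff : (100 * (r * r + r * b) < 14 * n + 100 * r)%N.
  by split; [lia|move=> ?; split; lia].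
by rewrite -(ltn_pmul2l b0); lia.
Qed.

(** * Adjacency matrices of regular and strongly regular graphs *)

Section AdjacencyMatrix.
Variables (R : pzRingType) (T : finType) (e : rel T).
Hypothesis e_sym : symmetric e.
Local Notation A := (adjacency_mx R e).
Local Notation J := (const_mx 1 : 'M[R]_#|T|).

Lemma adjacency_mx_sqr i j :
  (A *m A) i j =
    #|neighbors e (enum_val i) :&: neighbors e (enum_val j)|%:R.
Proof.
rewrite mxE -sum1_card natr_sum [RHS]big_mkcond [RHS]big_enum_val /=.
apply: eq_bigr => l _; rewrite !mxE !inE (e_sym (enum_val l)).
by case: (e _ _); case: (e _ _); rewrite ?mulr0 ?mulr1.
Qed.

Lemma adjacency_mx_mul_const k :
  (forall x, #|neighbors e x| = k) -> A *m J = k%:R *: J.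
Proof.
move=> reg; apply/matrixP => i j.
rewrite !mxE mulr1 -(reg (enum_val i)) -sum1_card natr_sum [RHS]big_mkcond.
rewrite [RHS]big_enum_val; apply: eq_bigr => l _; rewrite !mxE inE mulr1.
by case: (e _ _).
Qed.

Lemma tr_adjacency_mx : A^T = A.
Proof. by apply/matrixP => i j; rewrite !mxE e_sym. Qed.

End AdjacencyMatrix.

Lemma const_mx_adjacency_mul (R : comPzRingType) (T : finType) (e : rel T) k :
  symmetric e -> (forall x, #|neighbors e x| = k) ->
  const_mx 1 *m adjacency_mx R e = k%:R *: const_mx 1 :> 'M[R]_#|T|.
Proof.
move=> e_sym reg; apply: trmx_inj; rewrite trmx_mul tr_adjacency_mx //.
by rewrite trmx_const (adjacency_mx_mul_const _ reg) linearZ /= trmx_const.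
Qed.

Lemma adjacency_mx_quadratic (R : pzRingType) (T : finType) (e : rel T)
    (n k b : nat) :
  simple_graph e -> strongly_regular e n k 0 b ->
  let A := adjacency_mx R e in
  A *m A = (k%:R - b%:R)%:M - b%:R *: A + b%:R *: const_mx 1.
Proof.
move=> [e_sym e_irr] [_ reg adj nadj] /=; apply/matrixP => i j.
rewrite adjacency_mx_sqr // !mxE mulr1.
have [<-|ij] := eqVneq i j.
  by rewrite setIid reg e_irr mulr1n mulr0 subr0 subrK.
rewrite mulr0n add0r; have [eij|eij] := boolP (e _ _).
  by rewrite adj // mulr1 addNr.
by rewrite nadj ?(inj_eq enum_val_inj) // mulr0 oppr0 add0r.
Qed.

(** * Eigenvalues and the least eigenspace from the quadratic equation *)

Section QuadraticMatrix.
Variables (R : realFieldType) (m : nat) (A : 'M[R]_m) (k b r s : R).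
Local Notation J := (const_mx 1 : 'M[R]_m).
Hypothesis m_gt0 : (0 < m)%N.
Hypothesis AJ : A *m J = k *: J.
Hypothesis JA : J *m A = k *: J.
Hypothesis AA : A *m A = (k - b)%:M - b *: A + b *: J.
Hypothesis rs_prod : r * s = k - b.
Hypothesis rs_diff : s - r = b.

Lemma const_mx1_mul : J *m J = m%:R *: J.
Proof.
apply/matrixP => i j; rewrite !mxE (eq_bigr (fun=> 1)) => [|l _].
  by rewrite sumr_const card_ord mulr1.
by rewrite !mxE mulr1.
Qed.

(** Multiplying the quadratic equation by [J] compares row sums: [k^2 = k - b - b k + b m]. *)
Lemma quadratic_mx_count : b * m%:R = (k - r) * (k + s).
Proof.
have : (A *m A) *m J = (k * k) *: J by rewrite -mulmxA AJ -scalemxAr AJ scalerA.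
rewrite AA !mulmxDl mulNmx -!scalemxAl AJ const_mx1_mul mul_scalar_mx.
move/matrixP/(_ (Ordinal m_gt0) (Ordinal m_gt0)); rewrite !mxE => h.
by move: rs_prod rs_diff h; nra.
Qed.

(** If [x != k], evaluating [v A J] in two ways gives [v J = 0]; the [J] term then drops out and [x]
    is a root of the quadratic. *)
Lemma quadratic_mx_eigenvalue x :
  eigenvalue A x -> [\/ x = k, x = r | x = - s].
Proof.
case/eigenvalueP => v vA v0.
have vAJ : (x - k) *: (v *m J) = 0.
  by rewrite scalerBl scalemxAl -vA -mulmxA AJ -scalemxAr subrr.
move/eqP: vAJ; rewrite scaler_eq0 subr_eq0 => /orP[/eqP|/eqP vJ].
  exact: Or31.
have : (x * x) *: v = v *m (A *m A) by rewrite mulmxA vA -scalemxAl vA scalerA.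
rewrite AA !mulmxDr mulmxN -!scalemxAr vA vJ scaler0 addr0 mul_mx_scalar.
rewrite scalerA -scalerBl => /eqP; rewrite -subr_eq0 -scalerBl scaler_eq0.
rewrite (negPf v0) orbF => h.
have : (x - r) * (x + s) == 0.
  by apply/eqP; move/eqP: h; move: rs_prod rs_diff; nra.
rewrite mulf_eq0 subr_eq0 addr_eq0 => /orP[] /eqP; first exact: Or32.
exact: Or33.
Qed.

Lemma quadratic_mx_eigenvalue_degree : eigenvalue A k.
Proof.
apply/eigenvalueP; exists (row (Ordinal m_gt0) J).
  by rewrite -row_mul JA linearZ.
apply/eqP => /matrixP/(_ 0 (Ordinal m_gt0)); rewrite !mxE => /eqP.
by rewrite oner_eq0.
Qed.

(** The weight of [J] for which the projection below annihilates the all-ones vector. *)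
Let c := (k - r) / m%:R.

(* A multiple of the projection onto the eigenspace of [- s]. *)
Definition least_eigenprojection := r%:M - A + c *: J.
Local Notation F := least_eigenprojection.

Let cm : c * m%:R = k - r.
Proof. by rewrite /c divfK // pnatr_eq0 -lt0n. Qed.

Let bc : b = c * (k + s).
Proof.
apply: (mulIf (_ : m%:R != 0)); first by rewrite pnatr_eq0 -lt0n.
by rewrite quadratic_mx_count -cm; ring.
Qed.

Lemma least_eigenprojection_mul : F *m A = - s *: F.
Proof.
rewrite /F mulmxDl mulmxBl AA -scalemxAl JA mul_scalar_mx.
rewrite -rs_prod; apply/matrixP => i j; rewrite !mxE.
(* This matches the coefficients of [J] on the two sides. *)
have e1 : - b + c * k = - s * c by rewrite [in LHS]bc; ring.
have e2 : b = s - r by rewrite -rs_diff.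
have e3 : c * k = - s * c + b by rewrite -e1; ring.
rewrite !mulr1 e3 {1}e2.
case: (i == j); rewrite ?mulr1n ?mulr0n; ring.
Qed.

Lemma least_eigenprojection_const : F *m J = 0.
Proof.
rewrite /F mulmxDl mulmxBl AJ -scalemxAl const_mx1_mul mul_scalar_mx.
by rewrite scalerA cm -scalerBl -scalerDl addrC subrKA subrr scale0r.
Qed.

Lemma least_eigenprojection_sqr : F *m F = (r + s) *: F.
Proof.
rewrite {2}/F mulmxDr mulmxBr least_eigenprojection_mul -scalemxAr.
rewrite least_eigenprojection_const scaler0 addr0 mul_mx_scalar.
by rewrite scaleNr opprK scalerDl.
Qed.

Lemma least_eigenprojection_trace :
  \tr A = 0 -> (r + s) * (\rank F)%:R = k + r * (m%:R - 1).
Proof.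
move=> trA; rewrite -(mxtrace_quasi_idempotent least_eigenprojection_sqr).
rewrite /F !mxtraceD raddfN /= trA mxtrace_scalar mxtraceZ.
have -> : \tr J = m%:R.
  rewrite /mxtrace (eq_bigr (fun=> 1)) => [|i _]; last by rewrite mxE.
  by rewrite sumr_const card_ord.
by rewrite cm -mulr_natr; ring.
Qed.

Lemma quadratic_mx_eigenvalue_least : F != 0 -> eigenvalue A (- s).
Proof.
case/rowV0Pn => v /submxP[w ->] v0; apply/eigenvalueP; exists (w *m F) => //.
by rewrite -mulmxA least_eigenprojection_mul -scalemxAr.
Qed.

(* The block of [F] on such an index set is [r I + c J], which is regular. *)
Lemma least_eigenprojection_rank p (f : 'I_p -> 'I_m) :
  injective f -> (forall i j, A (f i) (f j) = 0) -> 0 < r -> r <= k ->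
  (p <= \rank F)%N.
Proof.
move=> f_inj fA r0 rk; apply: leq_trans (mxrank_mxsub f f F).
have -> : mxsub f f F = r%:M + const_mx c.
  apply/matrixP => i j; rewrite !mxE fA subr0 mulr1.
  by rewrite (inj_eq f_inj).
suff /eqP -> : row_free (r%:M + const_mx c : 'M_p) by [].
by apply: row_free_scalar_plus_const; rewrite // divr_ge0 ?subr_ge0 ?ler0n.
Qed.

End QuadraticMatrix.

(** * Arithmetic of the parameters *)

(** From [u^2 d = w^2] it follows that [u^2] divides [w^2], hence [u] divides [w]. *)
Lemma rational_sqrt_nat (R : realFieldType) (q : R) (d : nat) (u w : int) :
  0 <= q -> q ^+ 2 = d%:R -> u != 0 -> u%:~R * q = w%:~R ->
  exists t : nat, q = t%:R.
Proof.
move=> q0 q2 u0 uq.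
have : (u ^+ 2 * d%:Z)%:~R = (w ^+ 2)%:~R :> R.
  by rewrite rmorphM !rmorphXn /= -uq exprMn q2.
move/intr_inj/(congr1 absz); rewrite abszM !abszX /= => h.
have /dvdnP[t wE] : (`|u| %| `|w|)%N.
  by rewrite -(dvdn_pexp2r _ _ (isT : 0 < 2)%N) -h dvdn_mulr.
move: h; rewrite wE expnMn mulnC => /eqP.
rewrite eqn_pmul2r ?expn_gt0 ?absz_gt0 ?u0 // => /eqP dE.
exists t; apply/eqP; rewrite -(@eqrXn2 _ 2) //.
by rewrite q2 dE natrX.
Qed.

Section ParameterBound.
Variables (R : realFieldType) (n k b g : nat) (r s : R).
Hypotheses (n_gt0 : (0 < n)%N) (k_gt1 : (1 < k)%N) (b_gt0 : (0 < b)%N).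
Hypotheses (r_ge0 : 0 <= r) (rs_prod : r * s = k%:R - b%:R).
Hypotheses (rs_diff : s - r = b%:R).
Hypothesis count : b%:R * n%:R = (k%:R - r) * (k%:R + s).
Hypothesis mult : (r + s) * g%:R = k%:R + r * (n%:R - 1).

Let sE : s = r + b%:R. Proof. by rewrite -rs_diff; ring. Qed.
Let kE : k%:R = r * r + r * b%:R + b%:R.
Proof. by move: rs_prod; rewrite sE; lra. Qed.
Let b_ge1 : 1 <= b%:R :> R. Proof. by rewrite ler1n. Qed.

(** Only [r s] and [s - r] enter the expanded count, so it descends to natural numbers. *)
Let count_nat : (b * n + k = b * k.+1 + k * k)%N.
Proof.
apply/eqP; rewrite -(eqr_nat R) !natrD !natrM count sE -[k.+1]addn1 natrD.
by apply/eqP; rewrite kE; ring.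
Qed.

(* For triangle-free graphs this is the Krein condition. *)
Lemma parameter_krein : 0 < r -> (k <= g)%N -> b%:R <= r * (r + 1).
Proof.
move=> r0; rewrite -(ler_nat R) => kg.
have k0 : 0 < k%:R :> R by rewrite ltr0n; case: (k) k_gt1.
have x0 : 0 < r + b%:R - 1 by move: b_ge1; lra.
have h1 : (r + s) * k%:R <= k%:R + r * (n%:R - 1).
  by rewrite -mult ler_pM2l // sE; move: b_ge1; lra.
(* After elimination of [n] by [count], [b] times the slack in [h1] factors as
   [k (r + b - 1) (r (r + 1) - b)], whose first two factors are positive. *)
have h2 : k%:R * (r + b%:R - 1) * b%:R
          <= k%:R * (r + b%:R - 1) * (r * (r + 1)).
  rewrite -subr_ge0.
  have -> : k%:R * (r + b%:R - 1) * (r * (r + 1))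
          - k%:R * (r + b%:R - 1) * b%:R
    = b%:R * (k%:R + r * (n%:R - 1) - (r + s) * k%:R).
    have -> : b%:R * (k%:R + r * (n%:R - 1) - (r + s) * k%:R)
      = b%:R * k%:R + r * (b%:R * n%:R) - r * b%:R - b%:R * (r + s) * k%:R.
      by ring.
    by rewrite count sE kE; ring.
  by rewrite mulr_ge0 ?subr_ge0 // ler0n.
by rewrite ler_pM2l ?mulr_gt0 in h2.
Qed.

(** Substituting [2 r = (r + s) - b] in [mult] gives [(r + s) (2 g - (n - 1)) = 2 k - b (n - 1)].
    Either [r + s] is rational, or [2 g = n - 1], the case of equal multiplicities. *)
Lemma parameter_integral_or_pentagon :
  (exists r0 : nat, r = r0%:R) \/ [/\ n = 5, k = 2 & b = 1]%N.
Proof.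
have [u0|u0] := eqVneq (2 * g)%N n.-1.
  right.
  have nE : n = (2 * g).+1 by rewrite u0 prednK.
  have bn : (2 * k = b * (2 * g))%N.
    apply/eqP; rewrite -(eqr_nat R) !natrM.
    move: mult; rewrite nE -[X in X%:R - 1]addn1 natrD addrK natrM sE => h.
    by apply/eqP; lra.
  have kb : (k + b = 3)%N.
    move: count_nat; rewrite nE mulnS -bn => h.
    have : (k * (k + b) = k * 3)%N by lia.
    by move/eqP; rewrite eqn_pmul2l; [move/eqP|lia].
  have [bE kE'] : b = 1%N /\ k = 2%N by lia.
  by rewrite bE kE' in bn *; split=> //; lia.
left; have kb : (b <= k)%N.
  by rewrite -(ler_nat R) -subr_ge0 -rs_prod mulr_ge0 // sE addr_ge0 ?ler0n.
(* The discriminant of [x^2 + b x - (k - b)]; its square root is [r + s]. *)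
pose d := (b * b + 4 * (k - b))%N.
have q2 : (r + s) ^+ 2 = d%:R.
  by rewrite natrD !natrM natrB // kE sE; ring.
pose u : int := 2 * g%:Z - (n%:Z - 1).
pose w : int := 2 * k%:Z - b%:Z * (n%:Z - 1).
have [t tE] : exists t : nat, r + s = t%:R.
  apply: (@rational_sqrt_nat _ _ d u w) => //.
  - by rewrite sE !addr_ge0 ?ler0n.
  - by apply/eqP => uE; move/eqP: u0; apply; move: uE; rewrite /u; lia.
  rewrite /u /w !rmorphB !rmorphM /= !rmorphB /=.
  rewrite [_ * (r + s)]mulrC mulrBr.
  have -> : (r + s) * (2%:~R * g%:~R) = 2 * ((r + s) * g%:R) :> R.
    by rewrite -!pmulrn; ring.
  by rewrite mult sE -!pmulrn; ring.
have bt : (b <= t)%N by rewrite -(ler_nat R) -tE sE; move: r_ge0; lra.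
have tk : (t * t = d)%N.
  by apply/eqP; rewrite -(eqr_nat R) -q2 natrM tE expr2.
(* [t^2] and [b^2] differ by a multiple of 4, so [t] and [b] have the same parity. *)
have odd_tb : ~~ odd (t - b).
  rewrite oddB //; have := congr1 odd tk.
  by rewrite /d oddM oddD !oddM /= addbF !andbb => ->; rewrite addbb.
exists (t - b)./2.
have : (t - b)%:R = ((t - b)./2 * 2)%N%:R :> R by rewrite muln2 even_halfK.
by rewrite natrB // natrM -tE sE; move: r_ge0; lra.
Qed.

Lemma parameter_bound : (0 < r -> (k <= g)%N) ->
  k%:R - s <= 14 / 100 * n%:R /\
  (k%:R - s = 14 / 100 * n%:R <-> [/\ n = 100, k = 22 & b = 6]%N).
Proof.
move=> kg; have n0 : 0 < n%:R :> R by rewrite ltr0n.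
have [[r0 rE]|[nE kE' bE']] := parameter_integral_or_pentagon.
  have [r00|r0_gt0] := posnP r0.
    (* Here [k = b = s], as for complete bipartite graphs, so the left side is zero. *)
    rewrite kE sE rE r00; split; first lra.
    split=> [|[nE kE' bE']]; first lra.
    by move: kE; rewrite rE r00 kE' bE'; lra.
  have br : (b <= r0 * r0.+1)%N.
    rewrite -(ler_nat R) natrM -addn1 natrD -rE parameter_krein ?kg //.
      by rewrite rE ltr0n.
    by rewrite rE ltr0n.
  have kE0 : k = (r0 * r0 + r0 * b + b)%N.
    by apply/eqP; rewrite -(eqr_nat R) kE rE !natrD !natrM.
  have [le eq] := integral_parameter_bound r0_gt0 b_gt0 br kE0 count_nat.
  have ksE : k%:R - s = r0%:R * r0%:R + r0%:R * b%:R - r0%:R.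
    by rewrite kE sE rE; ring.
  have cast_l : (100 * (r0 * r0 + r0 * b))%N%:R
      = 100 * (r0%:R * r0%:R + r0%:R * b%:R) :> R.
    by rewrite natrM natrD !natrM.
  have cast_r : (14 * n + 100 * r0)%N%:R = 14 * n%:R + 100 * r0%:R :> R.
    by rewrite natrD !natrM.
  split.
    by move: le; rewrite -(ler_nat R) cast_l cast_r ksE; lra.
  split=> [h|[nE kE' bE']].
    apply: eq; apply/eqP; rewrite -(eqr_nat R) cast_l cast_r.
    by apply/eqP; move: h; rewrite ksE; lra.
  have r2 : r0 = 2%N.
    have [r_le|r_ge] := leqP r0 2; last by move: kE0; rewrite kE' bE'; nia.
    by case: (r0) r_le kE0 => [|[|[|]]] //; rewrite kE' bE'.
  by rewrite ksE nE r2 bE'; lra.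
have := kE; rewrite sE nE kE' bE' => h.
(* For the pentagon [r^2 + r = 1] and [k - s = 1 - r], to be compared with [7 / 10]. *)
have r3 : 3 / 10 < r by rewrite ltNge; apply/negP => r3; move: r_ge0 h; nra.
by split; [lra|split=> [?|[] //]; exfalso; lra].
Qed.

End ParameterBound.

(** * From graphs to parameters *)

Lemma quadratic_mx_spectrum (R : rcfType) m (A : 'M[R]_m) (k b r s : R)
    (mu : seq R) :
  (0 < m)%N -> A *m const_mx 1 = k *: const_mx 1 :> 'M_m ->
  const_mx 1 *m A = k *: const_mx 1 :> 'M_m ->
  A *m A = (k - b)%:M - b *: A + b *: const_mx 1 -> \tr A = 0 ->
  r * s = k - b -> s - r = b -> 0 <= r -> r <= k -> 0 <= s ->
  ordered_spectrum A mu -> mu`_0 = k /\ mu`_(size mu).-1 = - s.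
Proof.
move=> m0 AJ JA AA trA rs_prod rs_diff r0 rk s0 sp.
have ek := quadratic_mx_eigenvalue_degree m0 JA.
have es : eigenvalue A (- s).
  (* If the projection vanishes, its trace forces [k = r = 0], hence [s = 0], and [- s] is the
     eigenvalue [k]. *)
  have [F0|] := eqVneq (least_eigenprojection A k r) 0; last first.
    exact: (quadratic_mx_eigenvalue_least m0 AJ JA AA).
  have := least_eigenprojection_trace m0 AJ JA AA rs_prod rs_diff trA.
  rewrite F0 mxrank0 mulr0 => h.
  have rm : 0 <= r * (m%:R - 1) by rewrite mulr_ge0 // subr_ge0 ler1n.
  have k0 : k = 0 by lra.
  have r00 : r = 0 by lra.
  suff -> : - s = k by [].
  by move: rs_prod; rewrite r00 mul0r; lra.
split.
  apply: ordered_spectrum_head sp ek _ => y.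
  by case/(quadratic_mx_eigenvalue AJ AA rs_prod rs_diff) => ->; lra.
apply: ordered_spectrum_last sp es _ => y.
by case/(quadratic_mx_eigenvalue AJ AA rs_prod rs_diff) => ->; lra.
Qed.

Lemma mxtrace_adjacency (R : pzSemiRingType) (T : finType) (e : rel T) :
  irreflexive e -> \tr (adjacency_mx R e) = 0.
Proof. by move=> e_irr; apply: big1 => i _; rewrite mxE e_irr. Qed.

Lemma adjacency_mx_matching_sqr (R : pzRingType) (T : finType) (e : rel T) k :
  symmetric e -> (forall x, #|neighbors e x| = k) -> (k <= 1)%N ->
  adjacency_mx R e *m adjacency_mx R e = k%:R%:M.
Proof.
move=> e_sym reg k1; apply/matrixP => i j; rewrite adjacency_mx_sqr // mxE.
have [<-|ij] := eqVneq i j; first by rewrite setIid reg mulr1n.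
rewrite (_ : _ :&: _ = set0) ?cards0 //; apply/setP => z; rewrite !inE.
apply/negP => /andP[iz jz]; move: k1; rewrite -(reg z) leqNgt => /negP; apply.
apply/card_gt1P; exists (enum_val i), (enum_val j).
by rewrite !inE !(e_sym z) (inj_eq enum_val_inj).
Qed.

(** Two neighbours of one vertex serve, by triangle-freeness. Such a pair shows that [b] is positive
    and determined by the graph. *)
Lemma srg_nonadjacent_pair (T : finType) (e : rel T) (n k b : nat) :
  (0 < #|T|)%N -> symmetric e -> strongly_regular e n k 0 b -> (1 < k)%N ->
  exists y z, [/\ y != z, ~~ e y z
    & (0 < #|neighbors e y :&: neighbors e z|)%N].
Proof.
move=> /card_gt0P[x _] e_sym [_ reg adj _].
rewrite -(reg x) => /card_gt1P[y [z]]; rewrite !inE => -[xy xz yz].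
have xI : (0 < #|neighbors e y :&: neighbors e z|)%N.
  by apply/card_gt0P; exists x; rewrite !inE !(e_sym _ x) xy xz.
exists y, z; split=> //; apply/negP => /adj c0.
by rewrite c0 in xI.
Qed.

Lemma triangle_free_neighbors (T : finType) (e : rel T) (n k b : nat) x y z :
  symmetric e -> strongly_regular e n k 0 b ->
  y \in neighbors e x -> z \in neighbors e x -> e y z = false.
Proof.
move=> e_sym [_ _ adj _]; rewrite !inE => xy xz; apply/negP => /adj /eqP.
by rewrite cards_eq0 => /eqP/setP/(_ x); rewrite !inE !(e_sym _ x) xy xz.
Qed.

Lemma neighbors_rank_bound (R : rcfType) (T : finType) (e : rel T)
    (n k b : nat) (r : R) (x : T) :
  symmetric e -> strongly_regular e n k 0 b -> 0 < r -> r <= k%:R ->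
  (k <= \rank (least_eigenprojection (adjacency_mx R e) k%:R r))%N.
Proof.
move=> e_sym srg r0 rk; have [_ reg _ _] := srg; rewrite -{1}(reg x).
(* The index set is the neighbourhood of [x], enumerated and then re-indexed among all vertices. *)
apply: (@least_eigenprojection_rank _ _ _ _ _ _
  (fun i => enum_rank (enum_val i))) => //.
  exact: inj_comp enum_rank_inj enum_val_inj.
move=> i j; rewrite mxE !enum_rankK.
by rewrite (triangle_free_neighbors e_sym srg (enum_valP i) (enum_valP j)).
Qed.

Theorem theorem2 (R : rcfType) (T : finType) (e : rel T) (n k b : nat)
    (mu : n.-tuple R)
    (n_gt0 : (0 < n)%N)
    (Ge : simple_graph e)
    (Gsrg : strongly_regular e n k 0 b)
    (Gmu : ordered_spectrum (adjacency_mx R e) mu) :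
  mu`_0 + mu`_n.-1 <= 14 / 100 * n%:R /\
  (mu`_0 + mu`_n.-1 = 14 / 100 * n%:R <-> is_Higman_Sims e).
Proof.
have [e_sym e_irr] := Ge; have [nE reg _ nadj] := Gsrg.
have T_gt0 : (0 < #|T|)%N by rewrite nE.
have [x _] := card_gt0P T_gt0.
have AJ := adjacency_mx_mul_const R reg.
have JA := const_mx_adjacency_mul R e_sym reg.
have trA := mxtrace_adjacency R e_irr.
have nR : 0 < n%:R :> R by rewrite ltr0n.
(* For [k <= 1] there may be no non-adjacent pair to determine [b]; since [A^2 = k I], the spectral
   lemma applies with [b] replaced by 0 and [r = s = k]. *)
have [k_le1|k_gt1] := leqP k 1.
  have kk : k%:R * k%:R = k%:R - 0 :> R.
    by case: (k) k_le1 => [|[|]] //; rewrite ?mul0r ?mul1r subr0.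
  have AA : adjacency_mx R e *m adjacency_mx R e
      = (k%:R - 0)%:M - 0 *: adjacency_mx R e + 0 *: const_mx 1.
    by rewrite (adjacency_mx_matching_sqr _ e_sym reg k_le1) subr0 !scale0r
      subr0 addr0.
  have k0 : 0 <= k%:R :> R by exact: ler0n.
  have [->] := quadratic_mx_spectrum T_gt0 AJ JA AA trA kk (subrr _) k0 (lexx _)
    k0 Gmu.
  rewrite size_tuple => ->; rewrite subrr; split; first lra.
  split=> [|[_ reg22 _ _]]; first lra.
  by move: k_le1; rewrite -(reg x) reg22.
have AA := adjacency_mx_quadratic R Ge Gsrg.
have [y [z [yz eyz cyz]]] := srg_nonadjacent_pair T_gt0 e_sym Gsrg k_gt1.
have bE := nadj y z yz eyz.
have b_gt0 : (0 < b)%N by rewrite -bE.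
have bk : (b <= k)%N by rewrite -bE -(reg y) subset_leq_card // subsetIl.
pose q : R := Num.sqrt (b%:R ^+ 2 + 4 * (k%:R - b%:R)).
have bkR : b%:R <= k%:R :> R by rewrite ler_nat.
have b1 : 1 <= b%:R :> R by rewrite ler1n.
have q2 : q ^+ 2 = b%:R ^+ 2 + 4 * (k%:R - b%:R) by rewrite sqr_sqrtr //; nra.
have q0 : 0 <= q by exact: sqrtr_ge0.
pose r := (q - b%:R) / 2; pose s := (q + b%:R) / 2.
have rs_prod : r * s = k%:R - b%:R by rewrite /r /s; move: q2; nra.
have rs_diff : s - r = b%:R by rewrite /r /s; lra.
have r0 : 0 <= r.
  suff : b%:R <= q by rewrite /r; lra.
  by rewrite -(@ler_pXn2r _ 2) ?nnegrE //; lra.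
have s0 : 0 <= s by rewrite /s; lra.
(* As [s >= b >= 1], one has [r <= r s = k - b]. *)
have rk : r <= k%:R by move: rs_prod rs_diff; nra.
have [->] := quadratic_mx_spectrum T_gt0 AJ JA AA trA rs_prod rs_diff r0 rk s0
  Gmu.
rewrite size_tuple => ->.
have count := quadratic_mx_count T_gt0 AJ AA rs_prod rs_diff.
have mult := least_eigenprojection_trace T_gt0 AJ JA AA rs_prod rs_diff trA.
rewrite nE in count; rewrite [in RHS]nE in mult.
have [le eq] := parameter_bound n_gt0 k_gt1 b_gt0 r0 rs_prod rs_diff count mult
  (fun rp => neighbors_rank_bound x e_sym Gsrg rp rk).
split=> //; apply: (iff_trans eq); split=> [[nE' kE' bE']|[n100 reg22 _ nadj6]].
  by rewrite /is_Higman_Sims -nE' -kE' -bE'.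
(* The pair [y], [z] identifies [b] with 6. *)
by rewrite -nE n100 -(reg x) reg22 -bE nadj6.
Qed.
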